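(* Let $Y$ be a real topological vector space and let $A$ be a proper subset of $Y$ given by $A=\{y\in Y: g(y)\le b_g\text{ for all }g\in\Gamma\}$, where $\Gamma\subset Y^{*}\setminus\{0\}$ and $b_g\in\mathbb{R}$ for each $g\in\Gamma$, such that $0^+A\ne\{0\}$. Take any $k\in Y\setminus\{0\}$ with $g(k)\ge 0$ for all $g\in\Gamma$. (a) If $g(k)=0$ for all $g\in\Gamma$, then $\operatorname{dom}\varphi_{A,k}=A$ and $\varphi_{A,k}(y)=-\infty$ for each $y\in A$. (b) If there exists some $g_1\in\Gamma$ such that $g_1(k)>0$, then, with $\Gamma^{\rm act}:=\{g\in\Gamma: g(k)=0\}$, $$\operatorname{dom}\varphi_{A,k}=\Big\{y\in Y: g(y)\le b_g\text{ for all }g\in\Gamma^{\rm act}\text{ and }\sup_{g\in\Gamma\setminus\Gamma^{\rm act}}\frac{g(y)-b_g}{g(k)}\in\mathbb{R}\Big\}$$ and $$\varphi_{A,k}(y)=\sup_{g\in\Gamma\setminus\Gamma^{\rm act}}\frac{g(y)-b_g}{g(k)}\quad\text{for all }y\in\operatorname{dom}\varphi_{A,k}.$$ (c) If $\Gamma$ consists of a finite number of functions and $g(k)>0$ for all $g\in\Gamma$, then $\varphi_{A,k}$ is finite-valued with $$\varphi_{A,k}(y)=\max_{g\in\Gamma}\frac{g(y)-b_g}{g(k)}\quad\text{for all }y\in Y.$$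
   Context: $Y^{*}$ is the space of all continuous linear mappings from $Y$ into $\mathbb{R}$. $\mathbb{R}_{+}=\{x\in\mathbb{R}:x\ge 0\}$, $\overline{\mathbb{R}}=\mathbb{R}\cup\{-\infty,+\infty\}$, $\inf\emptyset=+\infty$. The recession cone of $A$ is $0^+A=\{u\in Y: A+\mathbb{R}_{+}u\subseteq A\}$. A proper subset of $Y$ is a nonempty subset different from $Y$. The Gerstewitz functional $\varphi_{A,k}:Y\to\overline{\mathbb{R}}$ is $\varphi_{A,k}(y)=\inf\{t\in\mathbb{R}: y\in A+tk\}$, with effective domain $\operatorname{dom}\varphi_{A,k}=\{y\in Y:\varphi_{A,k}(y)\in\mathbb{R}\cup\{-\infty\}\}$. It is finite-valued if it attains only real values on $Y$. Suprema are taken in $\overline{\mathbb{R}}$. *)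

(* Defs.v *)
From HB Require Import structures.
From mathcomp Require Import all_boot all_order all_algebra.
From mathcomp Require Import boolp classical_sets functions cardinality.
From mathcomp Require Import reals ereal topology normedtype.

Set Implicit Arguments.
Unset Strict Implicit.
Unset Printing Implicit Defensive.

Import Order.TTheory GRing.Theory Num.Theory.
Import numFieldNormedType.Exports.

Local Open Scope classical_set_scope.
Local Open Scope ring_scope.

Section Definitions.
Context {R : realType}.

(* A real topological vector space is a [topologicalLmodType R]: it is not
   assumed Hausdorff, nor locally convex, which rules out [tvsType]. *)

Definition topological_dual (Y : topologicalLmodType R) : set (Y -> R) :=
  [set g : Y -> R | scalar g /\ continuous g].

Definition recession_cone {Y : lmodType R} (A : set Y) : set Y :=
  [set u | [set a + t *: u | a in A & t in [set t : R | 0 <= t]] `<=` A].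

Definition gerstewitz {Y : lmodType R} (A : set Y) (k y : Y) : \bar R :=
  ereal_inf (EFin @` [set t : R | [set a + t *: k | a in A] y]).

Definition effective_domain {Y : Type} (f : Y -> \bar R) : set Y :=
  [set y | f y \is a fin_num \/ f y = -oo%E].

Definition finite_valued {Y : Type} (f : Y -> \bar R) : Prop :=
  forall y, f y \is a fin_num.

Definition is_max (S : set (\bar R)) (m : \bar R) : Prop :=
  S m /\ ubound S m.

Definition active {Y : Type} (Gamma : set (Y -> R)) (k : Y) : set (Y -> R) :=
  [set g | Gamma g /\ g k = 0].

End Definitions.

Arguments topological_dual {R} Y _.

(* Main.v *)
(* [y] lies in [A + t k] iff [g y - b g <= t * g k] for all [g] in [Gamma].  A
   constraint with [g k = 0] does not involve [t]; one with [g k > 0] says that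
   [t] is at least [(g y - b g) / g k].  So the set of admissible [t] is empty
   when an active constraint fails at [y], and otherwise it is the set of real
   upper bounds of these quotients, whose infimum is their supremum. *)
Require Import Defs.
From HB Require Import structures.
From mathcomp Require Import all_boot all_order all_algebra.
From mathcomp Require Import boolp classical_sets functions cardinality.
From mathcomp Require Import reals ereal topology normedtype.

Set Implicit Arguments.
Unset Strict Implicit.
Unset Printing Implicit Defensive.

Import Order.TTheory GRing.Theory Num.Theory.
Import numFieldNormedType.Exports.

Local Open Scope classical_set_scope.
Local Open Scope ring_scope.

(** Each real upper bound dominates the supremum, which gives one inequality. For the other, the
    real member [r] keeps the supremum away from [-oo]: if it is real, it is itself one of the
    bounds [t]; if it is [+oo], nothing is left to prove. *)
Lemma ereal_inf_real_ubounds (R : realType) (S : set (\bar R)) (r : R) :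
  S r%:E -> ereal_inf (EFin @` [set t : R | ubound S t%:E]) = ereal_sup S.
Proof.
move=> Sr; apply/eqP; rewrite eq_le; apply/andP; split; last first.
  by apply: le_ereal_inf_tmp => _ [t ubt <-]; exact: ge_ereal_sup.
have := ereal_sup_ubound Sr.
case supS : (ereal_sup S) => [x| |] // _; last by rewrite leey.
apply: ereal_inf_lbound; exists x => //= q Sq.
by rewrite -supS; exact: ereal_sup_ubound.
Qed.

Lemma finite_is_max (R : realType) (S : set (\bar R)) :
  finite_set S -> S !=set0 -> is_max S (ereal_sup S).
Proof.
case/finite_seqP => s -> [x0 x0s]; split; last exact: ereal_sup_ubound.
(* A largest entry of the list is its supremum; it is found by induction on the list. *)
suff [m ms lem] : exists2 m, m \in s & {in s, forall x, (x <= m)%E}.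
  suff -> : ereal_sup [set` s] = m by [].
  by apply/eqP; rewrite eq_le ge_ereal_sup ?ereal_sup_ubound //.
elim: s x0 x0s => [//|a s IHs] x0 _.
case: s IHs => [_|c s IHs].
  by exists a => [|x]; rewrite mem_seq1 // => /eqP ->.
have [m ms lem] := IHs c (mem_head c s).
have [am|ma] := leP a m.
  exists m => [|x]; first by rewrite inE ms orbT.
  by rewrite inE => /predU1P[->|/lem].
exists a => [|x]; first exact: mem_head.
by rewrite inE => /predU1P[->//|/lem /le_trans -> //]; exact: ltW.
Qed.

Lemma finite_is_max_image (R : realType) (T : Type) (D : set T)
    (f : T -> \bar R) :
  finite_set D -> D !=set0 -> is_max (f @` D) (ereal_sup (f @` D)).
Proof.
move=> finD [x Dx]; apply: finite_is_max; first exact: finite_image.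
by exists (f x), x.
Qed.

(** The only candidate for [a] in [a + t *: k = y] is [y - t *: k], and linearity turns its
    constraints into inequalities in [t]. *)
Lemma gerstewitz_polyhedronE (R : realType) (Y : lmodType R)
    (Gamma : set (Y -> R)) (b : (Y -> R) -> R) (k y : Y) :
  (forall g, Gamma g -> scalar g) ->
  gerstewitz [set y | forall g, Gamma g -> g y <= b g] k y =
  ereal_inf (EFin @` [set t | forall g, Gamma g -> g y - b g <= t * g k]).
Proof.
move=> Glin; have gB g t : Gamma g -> g (y - t *: k) = g y - t * g k.
  by move=> /Glin lg; rewrite addrC -scaleNr lg mulNr addrC.
congr (ereal_inf (EFin @` _)); apply/seteqP; split => [t [a Aa ay] g Gg|t tP].
  by rewrite lerBlDr addrC -lerBlDr -gB // -ay addrK; exact: Aa.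
exists (y - t *: k); last exact: subrK.
by move=> g Gg; rewrite gB // lerBlDr addrC -lerBlDr; exact: tP.
Qed.

Lemma gerstewitz_polyhedron_pinfty (R : realType) (Y : lmodType R)
    (Gamma : set (Y -> R)) (b : (Y -> R) -> R) (k y : Y) :
  (forall g, Gamma g -> scalar g) ->
  ~ (forall g, active Gamma k g -> g y <= b g) ->
  gerstewitz [set y | forall g, Gamma g -> g y <= b g] k y = +oo%E.
Proof.
move=> Glin nact; rewrite gerstewitz_polyhedronE // -ereal_inf0.
congr ereal_inf; rewrite -(image_set0 EFin); congr (EFin @` _).
apply/seteqP; split => // t tP; apply: nact => g [Gg gk0].
by have := tP _ Gg; rewrite gk0 mulr0 subr_le0.
Qed.

Lemma gerstewitz_polyhedron_sup (R : realType) (Y : lmodType R)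
    (Gamma : set (Y -> R)) (b : (Y -> R) -> R) (k y : Y) :
  (forall g, Gamma g -> scalar g) ->
  (forall g, Gamma g -> 0 <= g k) ->
  (exists2 g, Gamma g & 0 < g k) ->
  (forall g, active Gamma k g -> g y <= b g) ->
  gerstewitz [set y | forall g, Gamma g -> g y <= b g] k y =
  ereal_sup [set ((g y - b g) / g k)%:E | g in Gamma `\` active Gamma k].
Proof.
move=> Glin k_ge0 [g1 Gg1 g1k] act; rewrite gerstewitz_polyhedronE //.
(* The quotient of [g1] serves as the real member of the set of quotients. *)
rewrite -(@ereal_inf_real_ubounds _ _ ((g1 y - b g1) / g1 k)); last first.
  by exists g1 => //; split => // -[_ g1k0]; rewrite g1k0 ltxx in g1k.
congr (ereal_inf (EFin @` _)); apply/seteqP; split => t tP.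
  move=> _ [g [Gg nact] <-]; rewrite lee_fin ler_pdivrMr; first exact: tP.
  by rewrite lt_neqAle k_ge0 // andbT eq_sym; apply/eqP => gk0; exact: nact.
move=> g Gg; have [gk0|gk_neq0] := eqVneq (g k) 0.
  by rewrite gk0 mulr0 subr_le0; exact: act.
rewrite -ler_pdivrMr ?lt_neqAle 1?eq_sym ?gk_neq0 ?k_ge0 // -lee_fin.
by apply: tP; exists g => //; split => // -[_ /eqP]; exact/negP.
Qed.

Theorem proposition13 (R : realType) (Y : topologicalLmodType R)
  (A : set Y) (Gamma : set (Y -> R)) (b : (Y -> R) -> R) (k : Y)
  (A_neq0 : A !=set0) (A_neqT : A <> setT)
  (A_def : A = [set y | forall g, Gamma g -> g y <= b g])
  (Gamma_dual : Gamma `<=` topological_dual Y `\` [set cst 0])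
  (recA : recession_cone A <> [set 0])
  (k_neq0 : k <> 0)
  (k_ge0 : forall g, Gamma g -> 0 <= g k) :
  (* (a) *)
  ((forall g, Gamma g -> g k = 0) ->
    effective_domain (gerstewitz A k) = A /\
    forall y, A y -> gerstewitz A k y = -oo%E) /\
  (* (b) *)
  ((exists2 g1, Gamma g1 & 0 < g1 k) ->
    effective_domain (gerstewitz A k) =
      [set y | (forall g, active Gamma k g -> g y <= b g) /\
               ereal_sup [set ((g y - b g) / g k)%:E
                         | g in Gamma `\` active Gamma k] \is a fin_num] /\
    forall y, effective_domain (gerstewitz A k) y ->
      gerstewitz A k y =
        ereal_sup [set ((g y - b g) / g k)%:E
                  | g in Gamma `\` active Gamma k]) /\
  (* (c) *)
  (finite_set Gamma -> (forall g, Gamma g -> 0 < g k) ->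
    finite_valued (gerstewitz A k) /\
    forall y,
      is_max [set ((g y - b g) / g k)%:E | g in Gamma] (gerstewitz A k y)).
Proof.
have Glin g : Gamma g -> scalar g by move=> /Gamma_dual[[]].
have oo_dom y : gerstewitz A k y = +oo%E ->
    ~ effective_domain (gerstewitz A k) y.
  by move=> yoo [|]; rewrite yoo.
split; [|split].
- move=> k_eq0.
  have A_Ny y : A y -> gerstewitz A k y = -oo%E.
    rewrite A_def => Ay; rewrite gerstewitz_polyhedronE //.
    (* No constraint involves [t], so every real [r] is admissible at a point of [A]. *)
    apply: eq_ninfty => r.
    apply: ereal_inf_lbound; exists r => //= g Gg.
    by rewrite k_eq0 // mulr0 subr_le0; exact: Ay.
  split=> //; apply/seteqP; split => y; last by move=> /A_Ny; right.
  (* All of [Gamma] is active here, so outside [A] an active constraint fails and the value is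
     [+oo]. *)
  move=> domy; apply: contrapT => nAy; apply: (oo_dom y) => //.
  rewrite A_def gerstewitz_polyhedron_pinfty // => act; apply: nAy.
  by rewrite A_def => g Gg; apply: act; split => //; exact: k_eq0.
- move=> k_gt0.
  have sup_phi y : (forall g, active Gamma k g -> g y <= b g) ->
      gerstewitz A k y =
      ereal_sup [set ((g y - b g) / g k)%:E | g in Gamma `\` active Gamma k].
    by rewrite A_def; exact: gerstewitz_polyhedron_sup.
  have dom_act y : effective_domain (gerstewitz A k) y ->
      forall g, active Gamma k g -> g y <= b g.
    move=> domy; apply: contrapT => nact; apply: (oo_dom y) => //.
    by rewrite A_def; exact: gerstewitz_polyhedron_pinfty.
  split; last by move=> y /dom_act; exact: sup_phi.
  apply/seteqP; split => [y domy|y [act fin]]; last by left; rewrite sup_phi.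
  have act := dom_act _ domy; split => //.
  (* The effective domain also admits the value [-oo]; it is excluded because the supremum is at
     least the real quotient of [g1]. *)
  case: domy; rewrite sup_phi // => supNy.
  have [g1 Gg1 g1k] := k_gt0.
  suff : (((g1 y - b g1) / g1 k)%:E <= -oo)%E by [].
  rewrite -supNy; apply: ereal_sup_ubound; exists g1 => //; split => //.
  by case=> _ g1k0; rewrite g1k0 ltxx in g1k.
- move=> finG k_gt0.
  have act0 : active Gamma k = set0.
    by apply/seteqP; split => // g [/k_gt0 + gk0]; rewrite gk0 ltxx.
  (* With no constraints [A] would be the whole space, against properness. *)
  have [g1 Gg1] : Gamma !=set0.
    apply/set0P/eqP => G0; apply: A_neqT; rewrite A_def G0.
    by apply/seteqP; split => // y _ g [].
  have max_phi y :
      is_max [set ((g y - b g) / g k)%:E | g in Gamma] (gerstewitz A k y).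
    rewrite A_def gerstewitz_polyhedron_sup ?act0 ?setD0 //.
    + by apply: finite_is_max_image => //; exists g1.
    + by exists g1; last exact: k_gt0.
  (* Finiteness follows from attainment: the value is one of the real quotients. *)
  by split=> // y; have [[g _ <-] _] := max_phi y.
Qed.
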